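(* Let $n,m,l$ be positive integers with $\max(n,l)\le m$. Let $A\in\mathcal{T}(n,m)$, $A\neq 0$, be the asymmetric Toeplitz matrix $A=A(a,\alpha)+a_0I_{n\times m}$, and let $B\in\mathcal{T}(m,l)$, $B\ne 0$, be the asymmetric Toeplitz matrix $B=A(b,\beta)+b_0I_{m\times l}$, where $a=(0,a_1,\dots,a_{n-1})^T$, $\alpha=(0,\alpha_1,\dots,\alpha_{m-1})^T$, $b=(0,b_1,\dots,b_{m-1})^T$, $\beta=(0,\beta_1,\dots,\beta_{l-1})^T$. Then $AB\in\mathcal{T}(n,l)$ if and only if at least one of the following conditions holds: (1) $A$ is the asymmetric Toeplitz matrix with first column $(a_0,0,\dots,0)^T$ and first row $(a_0,\overline{\alpha}_1,\dots,\overline{\alpha}_{m-n},0,\dots,0)$ (that is, $a_i=0$ for $1\le i\le n-1$ and $\alpha_j=0$ for $m-n+1\le j\le m-1$); or $B$ is the asymmetric Toeplitz matrix with first column $(b_0,b_1,\dots,b_{m-l},0,\dots,0)^T$ and first row $(b_0,0,\dots,0)$ (that is, $b_i=0$ for $m-l+1\le i\le m-1$ and $\beta_j=0$ for $1\le j\le l-1$). (2) There is $\lambda\in\hat{\mathbb{C}}=\mathbb{C}\cup\{\infty\}$ such that $A=A(\tfrac1\lambda\hat{\alpha}_{(m,n)},\alpha)+a_0I_{n\times m}$ and $B=A(b,\overline{\lambda}\,\hat{b}_{(m,l)})+b_0I_{m\times l}$, where for $\lambda\in\mathbb{C}\setminus\{0\}$ this is read literally (i.e. $a=\tfrac1\lambda\hat\alpha_{(m,n)}$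 and $\beta=\overline\lambda\,\hat b_{(m,l)}$), for $\lambda=0$ it means $\hat{\alpha}_{(m,n)}=0$ and $\beta=0$ (with $a$ and $b$ unrestricted), and for $\lambda=\infty$ it means $a=0$ and $\hat{b}_{(m,l)}=0$ (with $\alpha$ and $\beta$ otherwise unrestricted).
   Context: Matrices are complex; rows and columns of an $n\times m$ matrix are numbered $0,\dots,n-1$ and $0,\dots,m-1$. An asymmetric Toeplitz matrix is an $n\times m$ matrix constant along each diagonal; $\mathcal{T}(n,m)$ is the set of all of them. For $a=(0,a_1,\dots,a_{n-1})^T\in\mathbb{C}^n$ and $\alpha=(0,\alpha_1,\dots,\alpha_{m-1})^T\in\mathbb{C}^m$, $A(a,\alpha)$ is the $n\times m$ matrix whose $(i,j)$ entry is $a_{i-j}$ if $i>j$, $0$ if $i=j$, and $\overline{\alpha}_{j-i}$ if $i<j$ (first column $a$, first row $\overline{\alpha}^T$). $I_{n\times m}$ is the $n\times m$ matrix with $(i,j)$ entry $1$ if $i=j$ and $0$ otherwise. Every $A\in\mathcal{T}(n,m)$ is uniquely $A=A(a,\alpha)+a_0I_{n\times m}$ with $a_0\in\mathbb{C}$. For $n\le m$ put $\hat{\alpha}_{(m,n)}=(0,\overline{\alpha}_{m-1},\dots,\overline{\alpha}_{m-n+1})^T\in\mathbb{C}^n$, and for $l\le m$ put $\hat{b}_{(m,l)}=(0,\overline{b}_{m-1},\dots,\overline{b}_{m-l+1})^T\in\mathbb{C}^l$. *)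

(* Defs.v *)
From mathcomp Require Import all_boot all_order all_algebra.
From mathcomp Require Import reals complex.

Set Implicit Arguments.
Unset Strict Implicit.
Unset Printing Implicit Defensive.

Import GRing.Theory Num.Theory.
Local Open Scope ring_scope.

Definition toeplitz (C : numClosedFieldType) (n m : nat) (A : 'M[C]_(n, m)) : Prop :=
  forall (i i' : 'I_n) (j j' : 'I_m), (i + j' = i' + j)%N -> A i j = A i' j'.

(* Entry of a column vector at a natural number index. The value 0 for k >= n
   is a placeholder: no definition below reads it when the sizes satisfy the
   stated bounds. *)
Definition entry (C : numClosedFieldType) (n : nat) (v : 'cV[C]_n) (k : nat) : C :=
  if insub k is Some i then v i 0 else 0.

(* First column a, first row the conjugate transpose of alpha; the entries of
   index 0 of a and alpha are not used. *)
Definition asym_toeplitz (C : numClosedFieldType) (n m : nat)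
    (a : 'cV[C]_n) (alpha : 'cV[C]_m) : 'M[C]_(n, m) :=
  \matrix_(i < n, j < m)
    if (j < i)%N then entry a (i - j)
    else if (i < j)%N then (entry alpha (j - i))^*
    else 0.

(* pid_mx n has entry 1 at (i, j) when i = j and i < n; for n rows the second
   requirement is automatic. *)
Definition rect_id (C : numClosedFieldType) (n m : nat) : 'M[C]_(n, m) := pid_mx n.

(* The vector (0, conj v_(m-1), ..., conj v_(m-n+1)), meant for n <= m. *)
Definition hat (C : numClosedFieldType) (m n : nat) (v : 'cV[C]_m) : 'cV[C]_n :=
  \col_(i < n) if (i == 0 :> nat)%N then 0 else (entry v (m - i))^*.

(* The extended complex plane; None is the point at infinity. *)
Definition extended (C : numClosedFieldType) : Type := option C.

Definition proportional_at (C : numClosedFieldType) (n m l : nat)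
    (A : 'M[C]_(n, m)) (a : 'cV[C]_n) (alpha : 'cV[C]_m) (a0 : C)
    (B : 'M[C]_(m, l)) (b : 'cV[C]_m) (beta : 'cV[C]_l) (b0 : C)
    (lambda : extended C) : Prop :=
  match lambda with
  | Some z =>
      if z == 0 then hat n alpha = 0 /\ beta = 0
      else A = asym_toeplitz (z^-1 *: hat n alpha) alpha + a0 *: rect_id C n m
        /\ B = asym_toeplitz b (z^* *: hat l b) + b0 *: rect_id C m l
  | None => a = 0 /\ hat l b = 0
  end.

(* Main.v *)
Require Import Defs.
From mathcomp Require Import all_boot all_order all_algebra.
From mathcomp Require Import reals complex.
From mathcomp Require Import zify.

Import GRing.Theory Num.Theory.
Local Open Scope ring_scope.

(** Write [X^*] for the conjugate transpose. Shifting the summation index of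
    [(A B)_(i+1, j+1)] by one and using that [A] and [B] are constant along
    diagonals, all terms cancel against those of [(A B)_(i, j)] except two:
    [(A B)_(i+1, j+1) - (A B)_(i, j)
       = A_(i+1, 0) B_(0, j+1) - A_(i, m-1) B_(m-1, j)]
    (lemma [mulmx_toeplitz_shift]). Up to conjugation, the four entries on the
    right are coordinates of [a], [beta], [hat n alpha] and [hat l b], so that
    [A B] is Toeplitz exactly when the matrices [a beta^*] and
    [(hat n alpha) (hat l b)^*], of rank at most one, coincide (lemma
    [toeplitz_mulmxP]). Two products of a column by a row agree only if both
    vanish, which means that a factor is zero on each side, or if the columns
    and the rows are proportional with inverse ratios (lemma
    [mulmx_col_row_eqP]). This gives five cases:
    - [a = 0] and [hat n alpha = 0], the condition on [A] alone;
    - [beta = 0] and [hat l b = 0], the condition on [B] alone;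
    - [a = 0] and [hat l b = 0], where lambda is infinite;
    - [hat n alpha = 0] and [beta = 0], where lambda is zero;
    - proportional vectors, where lambda is the ratio, finite and nonzero. *)

(** The row vector conjugate transpose of a column vector. *)
Definition conj_tr {C : numClosedFieldType} {n : nat} (v : 'cV[C]_n) : 'rV[C]_n :=
  \row_j (v j 0)^*.

Lemma conj_trZ (C : numClosedFieldType) (n : nat) (z : C) (v : 'cV[C]_n) :
  conj_tr (z *: v) = z^* *: conj_tr v.
Proof. by apply/rowP => j; rewrite !mxE rmorphM. Qed.

Lemma conj_tr_inj (C : numClosedFieldType) (n : nat) :
  injective (@conj_tr C n).
Proof.
move=> u v /rowP uv; apply/colP => j.
by have := uv j; rewrite !mxE => /(can_inj conjCK).
Qed.

Lemma conj_tr_eq0 (C : numClosedFieldType) (n : nat) (v : 'cV[C]_n) :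
  conj_tr v = 0 <-> v = 0.
Proof.
have E : conj_tr (0 : 'cV[C]_n) = 0 by apply/rowP => j; rewrite !mxE rmorph0.
by split=> [|->//]; rewrite -[RHS]E => /conj_tr_inj.
Qed.

(** * Equality of two matrices of rank at most one *)

Lemma mulmx_col_row_eq0 (F : fieldType) (n l : nat) (u : 'cV[F]_n) (x : 'rV[F]_l) :
  u *m x = 0 -> u = 0 \/ x = 0.
Proof.
move=> ux0; have [->|/rV0Pn[q xq0]] := eqVneq x 0; first by right.
left; apply/colP => p; have /matrixP/(_ p q) := ux0.
by rewrite !mxE big_ord1 => /eqP; rewrite mulf_eq0 (negPf xq0) orbF => /eqP.
Qed.

Lemma mulmx_col_row_eqP (F : fieldType) (n l : nat)
    (u v : 'cV[F]_n) (x y : 'rV[F]_l) :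
  u *m x = v *m y <->
  (u = 0 /\ v = 0 \/ y = 0 /\ x = 0) \/
  (u = 0 /\ y = 0 \/ v = 0 /\ x = 0) \/
  exists2 z, z != 0 & u = z^-1 *: v /\ x = z *: y.
Proof.
split; last first.
  case=> [[[-> ->]|[-> ->]]|[[[-> ->]|[-> ->]]|[z z0 [-> ->]]]];
    rewrite ?mul0mx ?mulmx0 //.
  by rewrite -scalemxAl -scalemxAr scalerA mulVf // scale1r.
move=> uxvy; have [ux0|ux0] := eqVneq (u *m x) 0.
  have vy0 : v *m y = 0 by rewrite -uxvy.
  have [u0|x0] := mulmx_col_row_eq0 _ _ _ _ _ ux0;
  have [v0|y0] := mulmx_col_row_eq0 _ _ _ _ _ vy0.
  - by left; left.
  - by right; left; left.
  - by right; left; right.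
  - by left; right.
have eqE p q : u p 0 * x 0 q = v p 0 * y 0 q.
  by have /matrixP/(_ p q) := uxvy; rewrite !mxE !big_ord1.
have /matrix0Pn[p [q]] := ux0.
rewrite !mxE big_ord1 => uxpq0; have vypq0 := uxpq0; rewrite eqE in vypq0.
move: uxpq0 vypq0; rewrite !mulf_eq0 !negb_or => /andP[up0 xq0] /andP[vp0 yq0].
(* The ratio is read off at a position where the common product is nonzero. *)
right; right; exists (v p 0 / u p 0); first by rewrite mulf_neq0 ?invr_eq0.
have ratioE : v p 0 / u p 0 = x 0 q / y 0 q.
  by apply/eqP; rewrite eqr_div // -eqE mulrC.
split.
  apply/colP => i; rewrite !mxE ratioE invf_div; apply: (mulIf xq0).
  by rewrite eqE mulrAC divfK // mulrC.
by apply/rowP => j; rewrite !mxE mulrAC -eqE mulrAC mulfV // mul1r.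
Qed.

(** * Toeplitz matrices and the difference of consecutive entries *)

(** It is enough to compare diagonally adjacent entries. *)
Lemma toeplitz_shiftP (C : numClosedFieldType) (n m : nat) (A : 'M[C]_(n, m)) :
  toeplitz A <->
  (forall (i i' : 'I_n) (j j' : 'I_m),
     i' = i.+1 :> nat -> j' = j.+1 :> nat -> A i' j' = A i j).
Proof.
split=> [tA i i' j j' ii' jj'|AS]; first by apply: tA; lia.
have Aadd d (i i' : 'I_n) (j j' : 'I_m) :
    i' = (i + d)%N :> nat -> j' = (j + d)%N :> nat -> A i' j' = A i j.
  elim: d i' j' => [|d IHd] i' j' ii' jj'.
    by congr (A _ _); apply: val_inj; rewrite /= ?ii' ?jj' addn0.
  have ltin : (i + d < n)%N by have := ltn_ord i'; lia.
  have ltjm : (j + d < m)%N by have := ltn_ord j'; lia.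
  rewrite (AS (Ordinal ltin) i' (Ordinal ltjm) j') /=; try lia.
  exact: IHd.
move=> i i' j j' ij; have [le_ii'|/ltnW le_i'i] := leqP i i'.
  by apply/esym/(Aadd (i' - i)%N); lia.
by apply: (Aadd (i - i')%N); lia.
Qed.

(** The sum for the entry [(i', j')] loses its first term and the sum for
    [(i, j)] its last one; what remains is the same sum. *)
Lemma mulmx_toeplitz_shift (C : numClosedFieldType) (n m l : nat)
    (A : 'M[C]_(n, m.+1)) (B : 'M[C]_(m.+1, l)) (i i' : 'I_n) (j j' : 'I_l) :
  toeplitz A -> toeplitz B -> i' = i.+1 :> nat -> j' = j.+1 :> nat ->
  (A *m B) i' j' - (A *m B) i j =
    A i' ord0 * B ord0 j' - A i ord_max * B ord_max j.
Proof.
move=> tA tB ii' jj'; rewrite !mxE big_ord_recl big_ord_recr /=.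
set s := \sum_(k < m) _; set t := \sum_(k < m) _.
have -> : s = t.
  apply: eq_bigr => k _; congr (_ * _); [apply: tA|apply: tB];
  by rewrite /= /bump; lia.
by rewrite addrKA.
Qed.

(** * Entries of a matrix in terms of its first column and first row *)

Lemma entry_ord (C : numClosedFieldType) (n : nat) (v : 'cV[C]_n) (i : 'I_n) :
  entry v i = v i 0.
Proof. by rewrite /entry valK. Qed.

Lemma entry_eq0P (C : numClosedFieldType) (n : nat) (v : 'cV[C]_n) :
  entry v 0 = 0 ->
  (forall i, (1 <= i <= n - 1)%N -> entry v i = 0) <-> v = 0.
Proof.
move=> v_0; split=> [v0|-> i _]; last first.
  by rewrite /entry; case: insubP => // k _ _; rewrite mxE.
apply/colP => i; rewrite mxE -entry_ord.
have [->//|i0] := eqVneq (i : nat) 0%N.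
by apply: v0; have := ltn_ord i; lia.
Qed.

Lemma hat_eq0P (C : numClosedFieldType) (m n : nat) (v : 'cV[C]_m) :
  (n <= m)%N ->
  (forall j, (m - n + 1 <= j <= m - 1)%N -> entry v j = 0) <-> hat n v = 0.
Proof.
move=> nm; split=> [v0|/colP h0 j jb].
  apply/colP => i; rewrite !mxE; case: eqP => // i0.
  by rewrite v0 ?rmorph0 //; have := ltn_ord i; lia.
have ltn : (m - j < n)%N by lia.
have := h0 (Ordinal ltn); rewrite !mxE /= ifF; last by apply/eqP; lia.
by rewrite subKn; [move/eqP; rewrite conjC_eq0 => /eqP|lia].
Qed.

(** The entries below and above the diagonal, where [a0] does not contribute. *)
Section ToeplitzEntries.
Variables (C : numClosedFieldType) (n m : nat).
Variables (a : 'cV[C]_n) (alpha : 'cV[C]_m) (a0 : C).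
Let A := asym_toeplitz a alpha + a0 *: rect_id C n m.

Lemma asym_toeplitz_lower (i : 'I_n) (j : 'I_m) :
  (j < i)%N -> A i j = entry a (i - j).
Proof.
by move=> ji; rewrite !mxE ji (gtn_eqF ji) mulr0 addr0.
Qed.

Lemma asym_toeplitz_upper (i : 'I_n) (j : 'I_m) :
  (i < j)%N -> A i j = (entry alpha (j - i))^*.
Proof.
by move=> ij; rewrite !mxE ltnNge (ltnW ij) ij (ltn_eqF ij) mulr0 addr0.
Qed.

End ToeplitzEntries.

(** The matrix determines both vectors, since its first column contains [a] and
    its first row contains the conjugate of [alpha]. The coordinates of index 0
    do not occur in the matrix and have to be compared separately. *)
Lemma asym_toeplitz_inj (C : numClosedFieldType) (n m : nat)
    (a a' : 'cV[C]_n) (alpha alpha' : 'cV[C]_m) (a0 : C) :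
  (0 < n)%N -> (0 < m)%N ->
  entry a 0 = entry a' 0 -> entry alpha 0 = entry alpha' 0 ->
  asym_toeplitz a alpha + a0 *: rect_id C n m =
    asym_toeplitz a' alpha' + a0 *: rect_id C n m ->
  a = a' /\ alpha = alpha'.
Proof.
move=> n0 m0 e0 f0 /matrixP E; split.
  apply/colP => i; rewrite -!entry_ord.
  have [->//|i0] := eqVneq (i : nat) 0%N.
  have := E i (Ordinal m0); rewrite !asym_toeplitz_lower /= ?subn0 //; lia.
apply/colP => j; rewrite -!entry_ord.
have [->//|j0] := eqVneq (j : nat) 0%N.
have := E (Ordinal n0) j; rewrite !asym_toeplitz_upper /= ?subn0; try lia.
exact: (can_inj conjCK).
Qed.

(** The coordinates of index 0 vanish in [a], [beta] and both hats, so that the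
    matrix equation imposes exactly the conditions found by shifting. *)
Lemma toeplitz_mulmxP (C : numClosedFieldType) (n m l : nat)
    (A : 'M[C]_(n, m)) (a : 'cV[C]_n) (alpha : 'cV[C]_m) (a0 : C)
    (B : 'M[C]_(m, l)) (b : 'cV[C]_m) (beta : 'cV[C]_l) (b0 : C) :
  (n <= m)%N -> (l <= m)%N -> entry a 0 = 0 -> entry beta 0 = 0 ->
  toeplitz A -> A = asym_toeplitz a alpha + a0 *: rect_id C n m ->
  toeplitz B -> B = asym_toeplitz b beta + b0 *: rect_id C m l ->
  toeplitz (A *m B) <->
  a *m conj_tr beta = hat n alpha *m conj_tr (hat l b).
Proof.
case: m A alpha B b => [|m] A alpha B b le_nm le_lm a_0 beta_0 tA defA tB defB.
  have n0 : n = 0%N by lia.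
  split=> _; first by apply/matrixP => i; have := ltn_ord i; lia.
  by move=> i; have := ltn_ord i; lia.
have cornerE (i i' : 'I_n) (j j' : 'I_l) :
    i' = i.+1 :> nat -> j' = j.+1 :> nat ->
    (A *m B) i' j' - (A *m B) i j =
    (a *m conj_tr beta) i' j' - (hat n alpha *m conj_tr (hat l b)) i' j'.
  move=> ii' jj'; rewrite (mulmx_toeplitz_shift _ _ _ _ _ _ i _ j) // defA defB.
  have lti := ltn_ord i'; have ltj := ltn_ord j'.
  rewrite asym_toeplitz_lower /=; last by rewrite ii'.
  rewrite asym_toeplitz_upper /=; last by rewrite jj'.
  rewrite asym_toeplitz_upper /=; last by lia.
  rewrite asym_toeplitz_lower /=; last by lia.
  rewrite mxE [(hat n alpha *m _) _ _]mxE !big_ord1 !mxE !subn0 !entry_ord.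
  by rewrite ii' jj' /= !subSS conjCK.
split=> [/toeplitz_shiftP tAB|E].
  apply/matrixP => p q.
  have [p0|p0] := eqVneq (p : nat) 0%N.
    by rewrite !mxE !big_ord1 !mxE -!entry_ord p0 a_0 !mul0r.
  have [q0|q0] := eqVneq (q : nat) 0%N.
    by rewrite !mxE !big_ord1 !mxE -!entry_ord q0 beta_0 /= rmorph0 !mulr0.
  have ltp : (p.-1 < n)%N by have := ltn_ord p; lia.
  have ltq : (q.-1 < l)%N by have := ltn_ord q; lia.
  have pE : p = (Ordinal ltp).+1 :> nat by rewrite /=; lia.
  have qE : q = (Ordinal ltq).+1 :> nat by rewrite /=; lia.
  by apply/eqP; rewrite -subr_eq0 -(cornerE _ _ _ _ pE qE) (tAB _ _ _ _ pE qE) subrr.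
apply/toeplitz_shiftP => i i' j j' ii' jj'.
by apply/eqP; rewrite -subr_eq0 (cornerE _ _ _ _ ii' jj') E subrr.
Qed.

(** For a finite nonzero parameter, proportionality of the matrices is
    proportionality of the vectors that define them. *)
Lemma proportional_at_neq0P (C : numClosedFieldType) (n m l : nat)
    (A : 'M[C]_(n, m)) (a : 'cV[C]_n) (alpha : 'cV[C]_m) (a0 : C)
    (B : 'M[C]_(m, l)) (b : 'cV[C]_m) (beta : 'cV[C]_l) (b0 z : C) :
  (0 < n)%N -> (0 < m)%N -> (0 < l)%N ->
  entry a 0 = 0 -> entry beta 0 = 0 ->
  A = asym_toeplitz a alpha + a0 *: rect_id C n m ->
  B = asym_toeplitz b beta + b0 *: rect_id C m l -> z != 0 ->
  proportional_at A a alpha a0 B b beta b0 (Some z) <->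
  a = z^-1 *: hat n alpha /\ beta = z^* *: hat l b.
Proof.
move=> n0 m0 l0 a_0 beta_0 defA defB z0; rewrite /proportional_at (negPf z0).
have hat_0 k p (kp : (0 < k)%N) (c : C) (v : 'cV[C]_p) :
    entry (c *: hat k v) 0 = 0.
  by rewrite (entry_ord _ _ _ (Ordinal kp)) !mxE eqxx mulr0.
split=> [[EA EB]|[<- <-] //].
have [| | | -> _] :=
  asym_toeplitz_inj _ _ _ a (z^-1 *: hat n alpha) alpha alpha a0 n0 m0.
- by rewrite hat_0.
- by [].
- by rewrite -defA.
have [| | | _ ->] :=
  asym_toeplitz_inj _ _ _ b b beta (z^* *: hat l b) b0 m0 l0.
- by [].
- by rewrite hat_0.
- by rewrite -defB.
by [].
Qed.

Local Open Scope complex_scope.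

Theorem theorem3p2 (R : realType) (n m l : nat)
    (n_gt0 : (0 < n)%N) (m_gt0 : (0 < m)%N) (l_gt0 : (0 < l)%N)
    (le_nl_m : (maxn n l <= m)%N)
    (A : 'M[R[i]]_(n, m)) (a : 'cV[R[i]]_n) (alpha : 'cV[R[i]]_m) (a0 : R[i])
    (B : 'M[R[i]]_(m, l)) (b : 'cV[R[i]]_m) (beta : 'cV[R[i]]_l) (b0 : R[i])
    (a_0 : entry a 0 = 0) (alpha_0 : entry alpha 0 = 0)
    (b_0 : entry b 0 = 0) (beta_0 : entry beta 0 = 0)
    (toepA : toeplitz A) (A_neq0 : A != 0)
    (defA : A = asym_toeplitz a alpha + a0 *: rect_id R[i] n m)
    (toepB : toeplitz B) (B_neq0 : B != 0)
    (defB : B = asym_toeplitz b beta + b0 *: rect_id R[i] m l) :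
  toeplitz (A *m B) <->
  (((forall i : nat, (1 <= i <= n - 1)%N -> entry a i = 0) /\
    (forall j : nat, (m - n + 1 <= j <= m - 1)%N -> entry alpha j = 0))
   \/
   ((forall i : nat, (m - l + 1 <= i <= m - 1)%N -> entry b i = 0) /\
    (forall j : nat, (1 <= j <= l - 1)%N -> entry beta j = 0)))
  \/
  (exists lambda : extended R[i],
     proportional_at A a alpha a0 B b beta b0 lambda).
Proof.
have [le_nm le_lm] : (n <= m)%N /\ (l <= m)%N by apply/andP; rewrite -geq_max.
have propP z := proportional_at_neq0P _ _ _ _ _ _ _ _ _ _ _ _ z
  n_gt0 m_gt0 l_gt0 a_0 beta_0 defA defB.
rewrite (toeplitz_mulmxP _ _ _ _ _ _ _ _ _ _ _ _ le_nm le_lm a_0 beta_0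
           toepA defA toepB defB).
rewrite mulmx_col_row_eqP !conj_tr_eq0 !entry_eq0P // !hat_eq0P //.
split=> [[cond1|[[inf|zero]|[z z0 [az betaz]]]]|[cond1|[[z|] prop]]].
- by left.
- by right; exists None.
- by right; exists (Some 0); rewrite /proportional_at eqxx.
- right; exists (Some z); apply/(propP _ z0); split=> //.
  by apply: conj_tr_inj; rewrite conj_trZ conjCK.
- by left.
- have [z0|z0] := eqVneq z 0.
    by move: prop; rewrite z0 /proportional_at eqxx; right; left; right.
  have [az betaz] := (propP _ z0).1 prop.
  right; right; exists z => //; split=> //.
  by rewrite betaz conj_trZ conjCK.
- by right; left; left.
Qed.
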